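(* Let $\mathcal{G}=(\mathcal{V},\mathcal{E})$ be a simple undirected graph with $n$ vertices, and let $k\in\{1,\dots,n-1\}$ be an integer. Then $$\theta_k(\mathcal{G})\le \Psi_k(\overline{\mathcal{G}}).$$
   Context: For a simple undirected graph $\mathcal{H}$ with vertex set $\{1,\dots,m\}$ and edge set $\mathcal{E}(\mathcal{H})$ and an integer $k\ge 1$, $\theta_k(\mathcal{H})$ is the optimal value of the semidefinite program: maximize $\langle I_m,X\rangle=\sum_i X_{ii}$ over real symmetric $m\times m$ matrices $X$ such that $X_{ij}=0$ for all $\{i,j\}\in\mathcal{E}(\mathcal{H})$; the $(m+1)\times(m+1)$ matrix $\begin{pmatrix} k & \mathrm{diag}(X)^\top\\ \mathrm{diag}(X) & X\end{pmatrix}$ is positive semidefinite; $X\ge 0$ entrywise; and $X_{ii}\le 1$ for all $i$. Here $\mathrm{diag}(X)$ is the vector of diagonal entries of $X$. $\overline{\mathcal{H}}$ denotes the complement graph of $\mathcal{H}$, $\chi(\mathcal{H})$ the chromatic number (equal to $0$ for the graph with no vertices), and for $\mathcal{S}\subseteq\mathcal{V}$, $\mathcal{H}-\mathcal{S}$ is the subgraph induced by $\mathcal{V}\setminus\mathcal{S}$. For a graph $\mathcal{H}$ with vertex set $\mathcal{V}$, $\Psi_k(\mathcal{H}):=\min\{k\,\chi(\mathcal{H}-\mathcal{S})+|\mathcal{S}| : \mathcal{S}\subseteq\mathcal{V}\}$. Thus $\Psi_k(\overline{\mathcal{G}})=\min\{k\,\overline{\chi}(\mathcal{G}-\mathcal{S})+|\mathcal{S}|:\mathcal{S}\subseteq\mathcal{V}\}$,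 where $\overline{\chi}$ is the clique cover number, $\overline{\chi}(\mathcal{H})=\chi(\overline{\mathcal{H}})$. *)

(* Defs.v *)
From mathcomp Require Import all_boot all_order all_algebra.
From mathcomp Require Import classical_sets reals constructive_ereal ereal.

Set Implicit Arguments.
Unset Strict Implicit.
Unset Printing Implicit Defensive.

Import Order.TTheory GRing.Theory Num.Theory.

Record sgraph (V : finType) := SGraph {
  edge :> rel V;
  edge_sym : symmetric edge;
  edge_irr : irreflexive edge }.

Section Graphs.

Variable V : finType.
Implicit Types (G : sgraph V) (S : {set V}).

Definition compl_edge G : rel V := fun x y => (x != y) && ~~ G x y.

Lemma compl_edge_sym G : symmetric (compl_edge G).
Proof. by move=> x y; rewrite /compl_edge eq_sym edge_sym. Qed.

Lemma compl_edge_irr G : irreflexive (compl_edge G).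
Proof. by move=> x; rewrite /compl_edge eqxx. Qed.

Definition compl G : sgraph V := SGraph (@compl_edge_sym G) (@compl_edge_irr G).

Definition del_edge G S : rel {x : V | x \notin S} :=
  fun x y => G (val x) (val y).

Lemma del_edge_sym G S : symmetric (@del_edge G S).
Proof. by move=> x y; apply: edge_sym. Qed.

Lemma del_edge_irr G S : irreflexive (@del_edge G S).
Proof. by move=> x; apply: edge_irr. Qed.

Definition del G S : sgraph {x : V | x \notin S} :=
  SGraph (@del_edge_sym G S) (@del_edge_irr G S).

Definition colorable G (c : nat) : bool :=
  [exists f : {ffun V -> 'I_c}, [forall x, forall y, G x y ==> (f x != f y)]].

Lemma colorable_ex G : exists c, colorable G c.
Proof.
exists #|V|; apply/existsP; exists [ffun x => enum_rank x].
apply/forallP => x; apply/forallP => y; apply/implyP => Gxy.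
rewrite !ffunE; apply/eqP => /enum_rank_inj xy.
by rewrite xy edge_irr in Gxy.
Qed.

Definition chi G : nat := ex_minn (colorable_ex G).

End Graphs.

Definition Psi_val (V : finType) (k : nat) (G : sgraph V) (S : {set V}) : nat :=
  k * chi (del G S) + #|S|.

(* [finset.set0] only seeds [arg min], which ranges over all of [{set V}]. *)
Definition Psi (V : finType) (k : nat) (G : sgraph V) : nat :=
  Psi_val k G [arg min_(S < finset.set0) Psi_val k G S].

Local Open Scope ring_scope.
Local Open Scope classical_set_scope.

Section Theta.

Variable R : realType.

Definition psdmx n (M : 'M[R]_n) : Prop :=
  M^T = M /\ forall v : 'cV[R]_n, 0 <= (v^T *m M *m v) 0 0.

Definition diag_col n (X : 'M[R]_n) : 'cV[R]_n := \col_i X i i.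

Definition bordered n (k : nat) (X : 'M[R]_n) : 'M[R]_(1 + n) :=
  block_mx (k%:R)%:M (diag_col X)^T (diag_col X) X.

Definition theta_feasible n (k : nat) (G : sgraph 'I_n) (X : 'M[R]_n) : Prop :=
  [/\ X^T = X,
      forall i j, G i j -> X i j = 0,
      psdmx (bordered k X),
      forall i j, 0 <= X i j &
      forall i, X i i <= 1].

Definition theta n (k : nat) (G : sgraph 'I_n) : \bar R :=
  ereal_sup [set (\tr X)%:E | X in [set X : 'M[R]_n | theta_feasible k G X]].

End Theta.

Arguments theta R {n} k G.

(* Main.v *)
Require Import Defs.
From mathcomp Require Import all_boot all_order all_algebra.
From mathcomp Require Import classical_sets reals constructive_ereal ereal.

(** A proper colouring of the complement of [G - S] with [c] colours partitions
    the vertices outside [S] into [c] cliques of [G].  Testing the bordered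
    matrix against [(1, -1_C)] for a clique [C] shows that the diagonal of [X]
    sums to at most [k] on [C], while each vertex of [S] contributes at
    most [1]. *)

Set Implicit Arguments.
Unset Strict Implicit.
Unset Printing Implicit Defensive.

Import Order.TTheory GRing.Theory Num.Theory.

Section CliqueBound.

Local Open Scope ring_scope.

(** The two cross terms are transposes of each other as 1-by-1 matrices, hence equal: this gives the
    factor 2, and [- u] gives its sign. *)
Lemma bordered_quad_form (R : realType) n k (X : 'M[R]_n) (u : 'cV[R]_n) :
  let v := col_mx 1%:M (- u) : 'cV[R]_(1 + n) in
  (v^T *m bordered k X *m v) 0 0 =
    k%:R - (\sum_i X i i * u i 0) *+ 2 + \sum_i \sum_j u i 0 * X i j * u j 0.
Proof.
rewrite /bordered /= tr_col_mx mul_row_block mul_row_col trmx1 !mul1mx mulmx1.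
rewrite !linearN /= !mulNmx mulmxBl opprB.
have -> : u^T *m diag_col X = (diag_col X)^T *m u.
  by apply/matrixP => i j; rewrite (ord1 i) (ord1 j) !mxE;
    apply: eq_bigr => l _; rewrite !mxE mulrC.
have eD : ((diag_col X)^T *m u) 0 0 = \sum_i X i i * u i 0.
  by rewrite !mxE; apply: eq_bigr => i _; rewrite !mxE.
have eX : (u^T *m X *m u) 0 0 = \sum_i \sum_j u i 0 * X i j * u j 0.
  rewrite mxE exchange_big /=; apply: eq_bigr => j _; rewrite mxE mulr_suml.
  by apply: eq_bigr => i _; rewrite !mxE.
have ek : ((k%:R)%:M : 'M[R]_1) 0 0 = k%:R by rewrite mxE mulr1n.
have addE (A B : 'M[R]_1) : (A + B) 0 0 = A 0 0 + B 0 0 by rewrite mxE.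
have oppE (A : 'M[R]_1) : (- A) 0 0 = - A 0 0 by rewrite mxE.
by rewrite !addE !oppE ek eD eX mulr2n opprD [X in _ + X]addrC !addrA.
Qed.

(** Write [s] for the diagonal sum over [C]. Off-diagonal entries of [X] inside a clique vanish, so
    the double sum in the quadratic form is again [s], and [k - 2s + s >= 0] gives the bound. *)
Lemma clique_diag_sum_le (R : realType) n k (G : sgraph 'I_n) (X : 'M[R]_n)
    (C : {set 'I_n}) :
  theta_feasible k G X ->
  {in C &, forall i j, i != j -> G i j} -> \sum_(i in C) X i i <= k%:R.
Proof.
case=> _ X0 [_ psdX] _ _ cliqueC.
have := psdX (col_mx 1%:M (- \col_i (i \in C)%:R)).
rewrite bordered_quad_form.
have -> : \sum_i X i i * (\col_i (i \in C)%:R : 'cV[R]_n) i 0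
          = \sum_(i in C) X i i.
  by rewrite [RHS]big_mkcond; apply: eq_bigr => i _; rewrite mxE mulr_natr mulrb.
have -> : \sum_i \sum_j (\col_i (i \in C)%:R : 'cV[R]_n) i 0 * X i j *
                        (\col_i (i \in C)%:R : 'cV[R]_n) j 0
          = \sum_(i in C) X i i.
  rewrite [RHS]big_mkcond; apply: eq_bigr => i _.
  rewrite (bigD1 i) //= big1 ?addr0 => [|j ji]; rewrite !mxE.
    by case: (i \in C); rewrite ?mul1r ?mulr1 ?mul0r.
  case: (boolP (i \in C)) => iC; last by rewrite !mul0r.
  case: (boolP (j \in C)) => jC; last by rewrite mulr0.
  by rewrite X0 ?mulr0 ?mul0r // cliqueC // eq_sym.
by rewrite mulr2n opprD addrA subrK subr_ge0.
Qed.

Lemma chi_colorable (V : finType) (G : sgraph V) : colorable G (chi G).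
Proof. by rewrite /chi; case: ex_minnP. Qed.

Lemma trace_le_Psi_val (R : realType) n k (G : sgraph 'I_n) (X : 'M[R]_n)
    (S : {set 'I_n}) :
  theta_feasible k G X -> \tr X <= (Psi_val k (compl G) S)%:R.
Proof.
move=> feasX; have [_ _ _ _ X1] := feasX.
have /existsP[f /forallP properf] := chi_colorable (del (compl G) S).
rewrite /mxtrace (bigID (mem S)) /= addrC /Psi_val natrD lerD //; last first.
  by rewrite -sumr_const ler_sum.
(* The sum outside [S] becomes a sum over the vertex type of [del (compl G) S], then is grouped by
   colour; each colour class should contribute at most [k]. *)
rewrite big_sub (partition_big f predT) //=.
have -> : (k * chi (del (compl G) S))%:R
          = \sum_(c < chi (del (compl G) S)) (k%:R : R).
  by rewrite sumr_const card_ord natrM mulr_natr.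
apply: ler_sum => c _.
have -> : \sum_(x | f x == c) X (val x) (val x)
          = \sum_(i in [set val x | x in [pred x | f x == c]]) X i i.
  by rewrite big_imset //= => x y _ _; apply: val_inj.
apply: (clique_diag_sum_le feasX).
move=> _ _ /imsetP[x /eqP fx ->] /imsetP[y /eqP fy ->] xy.
(* Distinct vertices not adjacent in [G] are adjacent in [compl G], so they could not share the
   colour [c]. *)
apply: contraTT (forallP (properf x) y) => nGxy.
by rewrite /= /del_edge /= /compl_edge xy nGxy fx fy eqxx.
Qed.

End CliqueBound.

Theorem theorem3p5 (R : realType) (n : nat) (G : sgraph 'I_n) (k : nat)
    (hk : 1 <= k <= n - 1) :
  (theta R k G <= (Psi k (compl G))%:R%:E)%E.
Proof.
(* The trace bound holds for every [S], in particular for the minimiser that defines [Psi]. *)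
apply: ge_ereal_sup => _ [X feasX <-]; rewrite lee_fin.
exact: trace_le_Psi_val.
Qed.
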